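(* Let $d$ be a derivation on $L$. If $d$ admits a graded right inverse $I$ on $L$ (i.e. a graded $k$-linear map $I:L\to L$ with $d\circ I=\mathrm{id}_L$), then for any $u\in L$ there exists $\varphi\in G$ such that $\log_d(\varphi)=u$.
   Context: Let $k$ be a field of characteristic $0$ and $\bigoplus_{n\ge1}L^k_n$ a graded Lie algebra over $k$ with finite-dimensional components and $[L^k_n,L^k_m]\subset L^k_{n+m}$. For a commutative $k$-algebra $\mathcal A$ (possibly $\mathcal A=k$), $L=L^{\mathcal A}=\prod_{n\ge1}L_n$ with $L_n=\mathcal A\otimes_k L^k_n$ and bracket induced by $[a\otimes x,b\otimes y]=(ab)\otimes[x,y]$, extended componentwise to the product. $\mathcal U=\prod_{n\ge0}\mathcal U_n$ is the completion of the graded universal enveloping algebra (over $k$) of $\bigoplus_n L_n$, with $\mathcal U_0=k\cdot1$, and $\mathcal U_{\ge1}=\prod_{n\ge1}\mathcal U_n$. $G\subset 1+\mathcal U_{\ge1}$ is the group of group-like elements of $\mathcal U$ for the coproduct with $\Delta(x)=1\otimes x+x\otimes1$ for $x\in L$; equivalently $G=\exp(L)$. A derivation on $L$ is a graded $k$-linear endomorphism $d$ ($d(L_n)\subset L_n$, acting componentwise) with $d([x,y])=[d(x),y]+[x,d(y)]$. It extends to a graded derivation of $\mathcal U$: $d(1)=0$, $d(\mathcal U_n)\subset\mathcal U_n$, $d(xy)=d(x)y+x\,d(y)$. For $\varphi\in1+\mathcal U_{\ge1}$, $\log_d(\varphi)=\varphi^{-1}d(\varphi)$. A map is called graded if it preserves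 each graded component (and acts componentwise). *)

(* Defs.v *)
From HB Require Import structures.
From mathcomp Require Import all_boot all_order all_algebra.
From mathcomp Require Import finmap boolp.
From mathcomp.multinomials Require Import monalg.

Set Implicit Arguments.
Unset Strict Implicit.
Unset Printing Implicit Defensive.

Import GRing.Theory.
Local Open Scope ring_scope.

Section Span.
Variables (k : fieldType) (M : lmodType k) (S : M -> Prop).

Inductive in_span : M -> Prop :=
| in_span0 : in_span 0
| in_spanP a x y : S x -> in_span y -> in_span (a *: x + y).

Definition lspan : {pred M} := fun x => `[< in_span x >].

Lemma lspanP x : reflect (in_span x) (x \in lspan).
Proof. exact: asboolP. Qed.

Lemma in_span_gen x : S x -> in_span x.
Proof.
move=> Sx; rewrite -[x]addr0 -[x]scale1r.
by apply: in_spanP => //; apply: in_span0.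
Qed.

Lemma lspan_submod_closed : submod_closed lspan.
Proof.
split; first by apply/lspanP/in_span0.
move=> a x y /lspanP Sx /lspanP Sy; apply/lspanP.
elim: Sx => [|b x' z Sx' _ IH]; first by rewrite scaler0 add0r.
by rewrite scalerDr scalerA -addrA; apply: in_spanP.
Qed.
HB.instance Definition _ :=
  GRing.isSubmodClosed.Build k M lspan lspan_submod_closed.

Let Q : Type := Quotient.quot lspan.
HB.instance Definition _ := GRing.Zmodule.on Q.
Let p (x : M) : Q := (\pi_(Quotient.quot lspan) x)%qT.
Let r (q : Q) : M := repr q.

Let rK q : p (r q) = q. Proof. exact: reprK. Qed.
Let p_eq x y : (p x == p y) = (x - y \in lspan).
Proof. by rewrite /p -Quotient.idealrBE. Qed.
Let pD : {morph p : x y / x + y}. Proof. exact: raddfD. Qed.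
Let sc (a : k) (q : Q) : Q := p (a *: r q).
Let pZ a x : p (a *: x) = sc a (p x).
Proof. by apply/eqP; rewrite p_eq -scalerBr rpredZ // -p_eq rK. Qed.

Let scA a b q : sc a (sc b q) = sc (a * b) q.
Proof. by rewrite -[q]rK -!pZ scalerA. Qed.
Let sc1 : left_id 1 sc.
Proof. by move=> q; rewrite -[q]rK -pZ scale1r. Qed.
Let scDr : right_distributive sc +%R.
Proof. by move=> a x y; rewrite -[x]rK -[y]rK -pD -!pZ scalerDr pD. Qed.
Let scDl q : {morph sc^~ q : a b / a + b}.
Proof. by move=> a b; rewrite -[q]rK -!pZ scalerDl pD. Qed.

HB.instance Definition _ := GRing.Zmodule_isLmodule.Build k Q scA sc1 scDr scDl.

Let p_linear : linear p. Proof. by move=> a x y; rewrite pD pZ. Qed.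
HB.instance Definition _ := GRing.isLinear.Build k M Q _ p p_linear.

(* The quotient M / span S.  As for every [_exists] below that ends with Qed,
   the construction is sealed behind its specification: unfolding the carriers
   (generic quotients, finitely supported functions) makes unification
   intractable. *)
Definition lquot_exists :
  {Q : lmodType k & {p : {linear M -> Q} & {r : Q -> M |
    cancel r p /\ forall x, p x = 0 <-> in_span x}}}.
Proof.
exists (Q : lmodType k), (p : {linear M -> Q}), r; split=> // x.
by rewrite -(raddf0 p); split=> [/eqP|/lspanP px]; last apply/eqP;
  rewrite p_eq subr0 // => /lspanP.
Qed.

Definition lquot : lmodType k := projT1 lquot_exists.
Definition lproj : {linear M -> lquot} := projT1 (projT2 lquot_exists).
Definition lrepr : lquot -> M := sval (projT2 (projT2 lquot_exists)).

Lemma lreprK : cancel lrepr lproj.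
Proof. exact: (svalP (projT2 (projT2 lquot_exists))).1. Qed.
Lemma lproj_eq0 x : lproj x = 0 <-> in_span x.
Proof. exact: (svalP (projT2 (projT2 lquot_exists))).2. Qed.
Lemma lproj_gen x : S x -> lproj x = 0.
Proof. by move=> Sx; apply/lproj_eq0/in_span_gen. Qed.

Lemma lrepr_lift (N : lmodType k) (F : {linear M -> N}) :
  (forall s, S s -> F s = 0) -> forall x, F (lrepr (lproj x)) = F x.
Proof.
move=> FS x; apply/eqP; rewrite -subr_eq0 -linearB; apply/eqP.
have : in_span (lrepr (lproj x) - x).
  by apply/lproj_eq0; rewrite linearB lreprK subrr.
elim=> [|a s y Ss _ IH]; first exact: linear0.
by rewrite linearP FS // scaler0 add0r.
Qed.

Definition lquot_lift (N : lmodType k) (F : {linear M -> N})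
  (FS : forall s, S s -> F s = 0) :
  {G : {linear lquot -> N} | forall x, G (lproj x) = F x}.
Proof.
pose G q := F (lrepr q); have GE x : G (lproj x) = F x by exact: lrepr_lift.
have G_lin : linear G.
  by move=> a x y; rewrite -[x]lreprK -[y]lreprK -linearP !GE linearP.
by exists (HB.pack_for {linear lquot -> N} G (GRing.isLinear.Build _ _ _ _ _ G_lin)).
Qed.

End Span.

Section LinearExtension.
Variables (k : fieldType) (X : choiceType).

Lemma malg_linear_ind (P : {malg k[X]} -> Prop) :
  P 0 -> (forall a x p, P p -> P (a *: << x >> + p)) -> forall p, P p.
Proof.
move=> P0 PS p; rewrite (monalgE p); elim: (msupp p : seq _) => [|x s IH].
  by rewrite big_nil.
rewrite big_cons; have -> : << p@_x *g x >> = p@_x *: << x >> :> {malg k[X]}.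
  by apply/malgP=> y; rewrite mcoeffZ !mcoeffU mulr_natr.
exact: PS.
Qed.

Definition lin_ext_exists (M : lmodType k) (h : X -> M) :
  {F : {linear {malg k[X]} -> M} | forall x, F << x >> = h x}.
Proof.
pose F (p : {malg k[X]}) : M := \sum_(x <- msupp p) p@_x *: h x.
have FEw D p : (msupp p `<=` D)%fset -> F p = \sum_(x <- D) p@_x *: h x.
  move=> le; rewrite [LHS](big_fset_incl _ le) => //= x xd /mcoeff_outdom ->.
  by rewrite scale0r.
have F_lin : linear F.
  move=> a p q; pose D := (msupp p `|` msupp q `|` msupp (a *: p + q))%fset.
  have [Dp Dq Dpq] : [/\ msupp p `<=` D, msupp q `<=` D
      & msupp (a *: p + q) `<=` D]%fset.
    by split; rewrite /D ?fsubsetUr // -?fsetUA ?fsubsetUl //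
      fsubsetU // fsubsetUl orbT.
  rewrite (FEw _ _ Dp) (FEw _ _ Dq) (FEw _ _ Dpq) scaler_sumr -big_split /=.
  by apply: eq_bigr => x _; rewrite mcoeffD mcoeffZ scalerDl scalerA.
exists (HB.pack_for {linear {malg k[X]} -> M} F
  (GRing.isLinear.Build _ _ _ _ _ F_lin)) => x /=.
by rewrite (FEw [fset x]%fset) ?msuppU_le // big_seq_fset1 mcoeffUU scale1r.
Qed.

Definition lin_ext (M : lmodType k) (h : X -> M) := sval (lin_ext_exists h).
Lemma lin_extU (M : lmodType k) (h : X -> M) x : lin_ext h << x >> = h x.
Proof. exact: (svalP (lin_ext_exists h)). Qed.

End LinearExtension.

Section FreeAlgebra.
Variables (k : fieldType) (X : choiceType).

Let malg_scalerAr (c : k) (p q : {malg k[{fmonom X}]}) : c *: (p * q) = p * (c *: q).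
Proof.
suff E : c%:MP * p = p * c%:MP.
  have := mulrA c%:MP p q; rewrite E -(mulrA p) => Epq.
  apply: etrans (esym (mul_malgC c (p * q))) _; apply: etrans Epq _.
  exact: (congr1 (fun r => p * r) (mul_malgC c q)).
rewrite !malgM_def fgmulUg fgmulgU; apply: eq_bigr => m _.
by rewrite mulrC mul1m mulm1.
Qed.

Let F : Type := {malg k[{fmonom X}]}.
HB.instance Definition _ := GRing.Lalgebra.on F.
HB.instance Definition _ := GRing.Lalgebra_isAlgebra.Build k F malg_scalerAr.

(* k<X>: the words form a basis. *)
Definition free_alg_exists :
  {F : algType k & {x : X -> F |
    (forall (N : lmodType k) (h : seq X -> N),
       exists G : {linear F -> N}, forall s, G (\prod_(i <- s) x i) = h s) /\
    (forall P : F -> Prop, P 0 ->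
       (forall a s p, P p -> P (a *: \prod_(i <- s) x i + p)) -> forall p, P p)}}.
Proof.
pose x i : F := << fmu i >>.
have wE s : \prod_(i <- s) x i = << FMonom s >>.
  elim: s => [|i s IH]; first by rewrite big_nil -fmoneE.
  rewrite big_cons IH malgM_def fgmulUU mulr1; congr (<< _ >>).
  by rewrite -[LHS]/(fmmul _ _) fmmulE fmuE.
exists (F : algType k), x; split=> [N h | P P0 PS].
  exists (lin_ext (fun m : {fmonom X} => h m)) => s.
  by rewrite wE; exact: (lin_extU (fun m : {fmonom X} => h m)).
elim/malg_linear_ind => [//|a m p Pp].
by have := PS a m p Pp; rewrite wE fmK.
Qed.

Definition free_alg : algType k := projT1 free_alg_exists.
Definition free_gen : X -> free_alg := sval (projT2 free_alg_exists).
Definition free_word (s : seq X) : free_alg := \prod_(i <- s) free_gen i.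

Lemma free_ext_exists (N : lmodType k) (h : seq X -> N) :
  exists G : {linear free_alg -> N}, forall s, G (free_word s) = h s.
Proof. exact: (svalP (projT2 free_alg_exists)).1. Qed.
Lemma free_ind (P : free_alg -> Prop) : P 0 ->
  (forall a s p, P p -> P (a *: free_word s + p)) -> forall p, P p.
Proof. exact: (svalP (projT2 free_alg_exists)).2. Qed.

Definition free_ext (N : lmodType k) (h : seq X -> N) : {linear free_alg -> N} :=
  sval (cid (free_ext_exists h)).
Lemma free_extE (N : lmodType k) (h : seq X -> N) s :
  free_ext h (free_word s) = h s.
Proof. exact: (svalP (cid (free_ext_exists h))). Qed.

Lemma free_word0 : free_word [::] = 1. Proof. exact: big_nil. Qed.
Lemma free_word1 i : free_word [:: i] = free_gen i. Proof. exact: big_seq1. Qed.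
Lemma free_wordM s t : free_word s * free_word t = free_word (s ++ t).
Proof. by rewrite /free_word big_cat. Qed.

End FreeAlgebra.

Section Tensor.
Variables (k : fieldType) (V W : lmodType k).

Inductive tens_rel : {malg k[(V * W)%type]} -> Prop :=
| tens_rell a v v' w :
    tens_rel (<< (a *: v + v', w) >> - a *: << (v, w) >> - << (v', w) >>)
| tens_relr a v w w' :
    tens_rel (<< (v, a *: w + w') >> - a *: << (v, w) >> - << (v, w') >>).

(* V (x)_k W, as the free module on V * W modulo bilinearity; [pure v w] below
   is v (x) w. *)
Definition tens_exists :
  {T : lmodType k & {t : {bilinear V -> W -> T} |
    (forall (N : lmodType k) (f : {bilinear V -> W -> N}),
       exists F : {linear T -> N}, forall v w, F (t v w) = f v w) /\
    (forall P : T -> Prop,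
       P 0 -> (forall v w s, P s -> P (t v w + s)) -> forall s, P s)}}.
Proof.
pose T := lquot tens_rel.
pose t (v : V) (w : W) : T := lproj tens_rel << (v, w) >>.
have tP : bilinear_for *:%R *:%R t.
  split=> [w a v v' | v a w w']; apply/eqP; rewrite -subr_eq0 opprD addrA.
    by have := lproj_gen (tens_rell a v v' w); rewrite !linearB linearZ => /eqP.
  by have := lproj_gen (tens_relr a v w w'); rewrite !linearB linearZ => /eqP.
pose tb := HB.pack_for {bilinear V -> W -> T} t
  (bilinear_isBilinear.Build _ _ _ _ _ _ _ tP).
exists T, tb; split=> [N f | P P0 PD s].
  pose F := lin_ext (fun vw : V * W => f vw.1 vw.2).
  have FS s : tens_rel s -> F s = 0.
    case=> [a v v' w | a v w w']; rewrite !linearB linearZ /= !lin_extU /=.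
      by rewrite linearPl addrAC addrK subrr.
    by rewrite linearPr addrAC addrK subrr.
  have [G GE] := lquot_lift FS; exists G => v w.
  by rewrite /= /t GE lin_extU.
rewrite -[s]lreprK.
elim/malg_linear_ind: (lrepr s) => [|a [v w] p Pp]; first by rewrite linear0.
have -> : lproj tens_rel (a *: << (v, w) >> + p)
    = tb (a *: v) w + lproj tens_rel p by rewrite linearP (linearZl_LR tb).
exact: PD.
Qed.

Definition tens : lmodType k := projT1 tens_exists.
Definition pure : {bilinear V -> W -> tens} := sval (projT2 tens_exists).

Lemma tens_lift_exists (N : lmodType k) (f : {bilinear V -> W -> N}) :
  exists F : {linear tens -> N}, forall v w, F (pure v w) = f v w.
Proof. exact: (svalP (projT2 tens_exists)).1. Qed.
Lemma tens_ind (P : tens -> Prop) :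
  P 0 -> (forall v w t, P t -> P (pure v w + t)) -> forall t, P t.
Proof. exact: (svalP (projT2 tens_exists)).2. Qed.

Definition tens_lift (N : lmodType k) (f : {bilinear V -> W -> N}) :
  {linear tens -> N} := sval (cid (tens_lift_exists f)).
Lemma tens_lift_pure (N : lmodType k) (f : {bilinear V -> W -> N}) v w :
  tens_lift f (pure v w) = f v w.
Proof. exact: (svalP (cid (tens_lift_exists f))). Qed.

End Tensor.
Arguments pure {k V W}.

Section TensorOp.
Variables (k : fieldType) (V V' V'' W W' W'' : lmodType k).
Variables (f : {bilinear V -> V' -> V''}) (g : {bilinear W -> W' -> W''}).

Definition tens_op_exists :
  {h : {bilinear tens V W -> tens V' W' -> tens V'' W''} |
    forall v w v' w', h (pure v w) (pure v' w') = pure (f v v') (g w w')}.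
Proof.
pose h1 v w v' w' := pure (f v v') (g w w').
have h1P v w : bilinear_for *:%R *:%R (h1 v w).
  by split=> [w' a x y | v' a x y]; rewrite /h1 linearPr ?linearPl ?linearPr.
pose H1 v w := HB.pack_for {bilinear V' -> W' -> tens V'' W''} (h1 v w)
  (bilinear_isBilinear.Build _ _ _ _ _ _ _ (h1P v w)).
pose h2 t v w := tens_lift (H1 v w) t.
have h2E v w v' w' : h2 (pure v' w') v w = h1 v w v' w'.
  exact: (tens_lift_pure (H1 v w)).
have h20 v w : h2 0 v w = 0 by exact: linear0.
have h2D s t v w : h2 (s + t) v w = h2 s v w + h2 t v w by exact: linearD.
have h2P t : bilinear_for *:%R *:%R (h2 t).
  split=> [w a v v' | v a w w']; elim/tens_ind: t => [|x y t IH];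
    rewrite ?h20 ?h2D /= ?scaler0 ?addr0 // IH scalerDr addrACA;
    congr (_ + _); rewrite !h2E /h1; first by rewrite !linearPl.
  by rewrite linearPl linearPr.
pose H2 t := HB.pack_for {bilinear V -> W -> tens V'' W''} (h2 t)
  (bilinear_isBilinear.Build _ _ _ _ _ _ _ (h2P t)).
pose h s t := tens_lift (H2 t) s.
have hE v w t : h (pure v w) t = h2 t v w by exact: (tens_lift_pure (H2 t)).
have h0 t : h 0 t = 0 by exact: linear0.
have hD s s' t : h (s + s') t = h s t + h s' t by exact: linearD.
have hP : bilinear_for *:%R *:%R h.
  split=> [t a s s' | s a t t']; first exact: linearP.
  elim/tens_ind: s => [|x y s IH]; first by rewrite !h0 /= scaler0 addr0.
  rewrite !hD IH /= scalerDr addrACA; congr (_ + _).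
  by rewrite !hE; exact: linearP.
exists (HB.pack_for {bilinear tens V W -> tens V' W' -> tens V'' W''} h
  (bilinear_isBilinear.Build _ _ _ _ _ _ _ hP)) => v w v' w' /=.
by rewrite hE h2E.
Qed.
Definition tens_op := sval tens_op_exists.
Lemma tens_op_pure v w v' w' :
  tens_op (pure v w) (pure v' w') = pure (f v v') (g w w').
Proof. exact: (svalP tens_op_exists). Qed.

End TensorOp.

Section AlgMul.
Variables (k : fieldType) (A : algType k).
Lemma alg_mul_bilinear : bilinear_for *:%R *:%R ( *%R : A -> A -> A).
Proof.
split=> [y a x x' | x a y y'] /=; first by rewrite mulrDl scalerAl.
by rewrite mulrDr scalerAr.
Qed.
Definition alg_mul : {bilinear A -> A -> A} :=
  HB.pack_for {bilinear A -> A -> A} ( *%R : A -> A -> A)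
    (bilinear_isBilinear.Build _ _ _ _ _ _ _ alg_mul_bilinear).
End AlgMul.

Section TensorAlgebra.
Variables (k : fieldType) (A B : algType k).

(* A (x)_k B with (a (x) b) (a' (x) b') = aa' (x) bb'.  Only a [pzRingType]: for
   arbitrary A and B, 1 != 0 is not proved here. *)
Definition tens_alg : Type := tens A B.
HB.instance Definition _ := GRing.Lmodule.on tens_alg.

Definition tmul : tens_alg -> tens_alg -> tens_alg :=
  tens_op (alg_mul A) (alg_mul B).
Definition tpure (a : A) (b : B) : tens_alg := pure a b.

Lemma tmul_pure a b a' b' :
  tmul (tpure a b) (tpure a' b') = tpure (a * a') (b * b').
Proof. exact: tens_op_pure. Qed.

Lemma tmulDl : left_distributive tmul +%R.
Proof. by move=> s t u; apply: linearDl. Qed.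
Lemma tmulDr : right_distributive tmul +%R.
Proof. by move=> s t u; apply: linearDr. Qed.
Lemma tmul0 t : tmul 0 t = 0.
Proof. exact: linear0l. Qed.
Lemma tmulr0 t : tmul t 0 = 0.
Proof. exact: linear0r. Qed.
Lemma tens_alg_ind (P : tens_alg -> Prop) :
  P 0 -> (forall a b t, P t -> P (tpure a b + t)) -> forall t, P t.
Proof. exact: tens_ind. Qed.

Lemma tmulA : associative tmul.
Proof.
move=> s t u; elim/tens_alg_ind: s => [|a b s IHs]; first by rewrite !tmul0.
rewrite !tmulDl {}IHs; congr (_ + _).
elim/tens_alg_ind: t => [|a' b' t IHt]; first by rewrite !(tmul0, tmulr0).
rewrite !(tmulDl, tmulDr) {}IHt; congr (_ + _).
elim/tens_alg_ind: u => [|a'' b'' u IHu]; first by rewrite !tmulr0.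
by rewrite !tmulDr IHu !tmul_pure !mulrA.
Qed.
Lemma tmul1 : left_id (tpure 1 1) tmul.
Proof.
elim/tens_alg_ind=> [|a b t IH]; first by rewrite tmulr0.
by rewrite tmulDr IH tmul_pure !mul1r.
Qed.
Lemma tmulr1 : right_id (tpure 1 1) tmul.
Proof.
elim/tens_alg_ind=> [|a b t IH]; first by rewrite tmul0.
by rewrite tmulDl IH tmul_pure !mulr1.
Qed.
HB.instance Definition _ := GRing.Zmodule_isPzRing.Build tens_alg
  tmulA tmul1 tmulr1 tmulDl tmulDr.

End TensorAlgebra.

(* A graded Lie algebra (+)_(n >= 1) V n, given by its homogeneous components and
   the brackets V i x V j -> V (i + j).  Indices are actual degrees, so that V 0
   is required to vanish.  The equations between degrees are arguments of [br],
   which avoids casts in the axioms.  Antisymmetry is the full alternating axiom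
   only when 2 is invertible in k. *)
Record gradedLie (k : fieldType) (V : nat -> lmodType k) := GradedLie {
  br : forall i j n, (i + j)%N = n -> {bilinear V i -> V j -> V n};
  br_anti : forall i j n (e : (i + j)%N = n) (e' : (j + i)%N = n) x y,
    br e x y = - br e' y x;
  br_jacobi : forall a b c ab bc ca n
    (eab : (a + b)%N = ab) (ebc : (b + c)%N = bc) (eca : (c + a)%N = ca)
    (e1 : (ab + c)%N = n) (e2 : (bc + a)%N = n) (e3 : (ca + b)%N = n) x y z,
    br e1 (br eab x y) z + br e2 (br ebc y z) x + br e3 (br eca z x) y = 0;
  gradedLie0 : forall x : V 0%N, x = 0
}.

Section ScalarExtension.
Variables (k : fieldType) (V : nat -> lmodType k) (g : gradedLie V).
Variable (A : comAlgType k).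

Let VA n : lmodType k := tens A (V n).
Let brA i j n (e : (i + j)%N = n) : {bilinear VA i -> VA j -> VA n} :=
  tens_op (alg_mul A) (br g e).
Let brAE i j n (e : (i + j)%N = n) a b x y :
  brA e (pure a x) (pure b y) = pure (a * b) (br g e x y).
Proof. exact: tens_op_pure. Qed.

Lemma lie_ext_anti i j n (e : (i + j)%N = n) (e' : (j + i)%N = n) x y :
  brA e x y = - brA e' y x.
Proof.
elim/tens_ind: x => [|a x s IHs]; first by rewrite linear0l linear0r oppr0.
rewrite linearDl linearDr opprD {}IHs; congr (_ + _).
elim/tens_ind: y => [|b y t IHt]; first by rewrite linear0l linear0r oppr0.
rewrite linearDl linearDr opprD IHt !brAE; congr (_ + _).
by rewrite (br_anti g e e') linearNr mulrC.
Qed.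

Let add3_eq0 (T : zmodType) (p q r p' q' r' : T) :
  p + q + r = 0 -> p' + q' + r' = 0 -> (p + p') + (q + q') + (r + r') = 0.
Proof. by move=> E E'; rewrite (addrACA p) (addrACA (p + q)) E E' addr0. Qed.

Lemma lie_ext_jacobi a b c ab bc ca n
    (eab : (a + b)%N = ab) (ebc : (b + c)%N = bc) (eca : (c + a)%N = ca)
    (e1 : (ab + c)%N = n) (e2 : (bc + a)%N = n) (e3 : (ca + b)%N = n) x y z :
  brA e1 (brA eab x y) z + brA e2 (brA ebc y z) x + brA e3 (brA eca z x) y = 0.
Proof.
elim/tens_ind: x => [|r x s IHs].
  by rewrite !(linear0l, linear0r) !addr0.
rewrite !(linearDl, linearDr); apply: (add3_eq0 _ IHs) => {s IHs}.
elim/tens_ind: y => [|r' y s' IHs'].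
  by rewrite !(linear0l, linear0r) !addr0.
rewrite !(linearDl, linearDr); apply: (add3_eq0 _ IHs') => {s' IHs'}.
elim/tens_ind: z => [|r'' z s'' IHs''].
  by rewrite !(linear0l, linear0r) !addr0.
rewrite !(linearDl, linearDr); apply: (add3_eq0 _ IHs'').
have -> := brAE eab r r' x y; have -> := brAE ebc r' r'' y z.
have -> := brAE eca r'' r z x; rewrite !brAE.
have -> : r' * r'' * r = r * r' * r'' by rewrite mulrC mulrA.
have -> : r'' * r * r' = r * r' * r'' by rewrite -mulrA mulrC.
by rewrite -!linearDr (br_jacobi g eab ebc eca) linear0r.
Qed.

Lemma lie_ext0 (x : VA 0) : x = 0.
Proof.
elim/tens_ind: x => [//|a x t ->]; rewrite addr0.
by rewrite (gradedLie0 g x) linear0r.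
Qed.

(* A (x)_k V with bracket [a (x) x, b (x) y] = ab (x) [x, y], seen over k. *)
Definition lie_ext : gradedLie (fun n => tens A (V n)) :=
  GradedLie lie_ext_anti lie_ext_jacobi lie_ext0.

End ScalarExtension.

(* A graded endomorphism of prod_n V n acts componentwise, hence is the family of
   its restrictions to the V n. *)
Record derivation (k : fieldType) (V : nat -> lmodType k) (g : gradedLie V) :=
  Derivation {
    der :> forall n, {linear V n -> V n};
    derP : forall i j n (e : (i + j)%N = n) x y,
      der n (br g e x y) = br g e (der i x) y + br g e x (der j y)
  }.

Section Enveloping.
Variables (k : fieldType) (V : nat -> lmodType k) (g : gradedLie V).

Local Notation X := {n : nat & V n}.
Local Notation F := (free_alg k X).

Definition gen n (x : V n) : F := free_gen k (existT (fun n => V n) n x).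

Inductive env_rel : F -> Prop :=
| env_rel_lin n a (x y : V n) :
    env_rel (gen (a *: x + y) - a *: gen x - gen y)
| env_rel_br i j n (e : (i + j)%N = n) (x : V i) (y : V j) :
    env_rel (gen x * gen y - gen y * gen x - gen (br g e x y)).

Definition env_ideal (p : F) : Prop :=
  exists a s b, env_rel s /\ p = a * s * b.

(* The universal enveloping algebra over k of (+)_n V n: generated by the
   homogeneous elements, subject to linearity in each V n and to
   xy - yx = [x, y]. *)
Definition env : Type := lquot env_ideal.
HB.instance Definition _ := GRing.Lmodule.on env.
Definition env_proj : {linear F -> env} := lproj env_ideal.

Lemma env_ideal_mul p q r : in_span env_ideal p -> in_span env_ideal (q * p * r).
Proof.
elim=> [|a x y [b [s [c [Ss ->]]]] _ IH]; first by rewrite mulr0 mul0r; constructor.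
rewrite mulrDr mulrDl -scalerAr -scalerAl.
by apply: in_spanP IH; exists (q * b), s, (c * r); rewrite !mulrA.
Qed.

Definition env_mul_exists :
  {m : env -> env -> env | forall p q, m (env_proj p) (env_proj q) = env_proj (p * q)}.
Proof.
exists (fun u v => env_proj (lrepr u * lrepr v)) => p q.
apply/eqP; rewrite -subr_eq0 -linearB; apply/eqP/lproj_eq0.
have diff x : in_span env_ideal (lrepr (env_proj x) - x).
  by apply/lproj_eq0; rewrite linearB lreprK subrr.
set p' := lrepr _; set q' := lrepr _.
have -> : p' * q' - p * q = 1 * (p' - p) * q' + p * (q' - q) * 1.
  by rewrite mul1r mulr1 mulrBl mulrBr addrA subrK.
by apply/lproj_eq0; rewrite linearD !(lproj_eq0 _ _).2 ?addr0 //;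
  apply: env_ideal_mul; apply: diff.
Qed.
Definition env_mul := sval env_mul_exists.
Lemma env_mulE p q : env_mul (env_proj p) (env_proj q) = env_proj (p * q).
Proof. exact: (svalP env_mul_exists). Qed.

Lemma env_surj (u : env) : exists p, u = env_proj p.
Proof. by exists (lrepr u); rewrite [RHS]lreprK. Qed.

Lemma env_mulA : associative env_mul.
Proof.
move=> u v w; have [p ->] := env_surj u; have [q ->] := env_surj v.
by have [r ->] := env_surj w; rewrite !env_mulE mulrA.
Qed.
Lemma env_mul1 : left_id (env_proj 1) env_mul.
Proof. by move=> u; have [p ->] := env_surj u; rewrite env_mulE mul1r. Qed.
Lemma env_mulr1 : right_id (env_proj 1) env_mul.
Proof. by move=> u; have [p ->] := env_surj u; rewrite env_mulE mulr1. Qed.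
Lemma env_mulDl : left_distributive env_mul +%R.
Proof.
move=> u v w; have [p ->] := env_surj u; have [q ->] := env_surj v.
by have [r ->] := env_surj w; rewrite -linearD !env_mulE mulrDl linearD.
Qed.
Lemma env_mulDr : right_distributive env_mul +%R.
Proof.
move=> u v w; have [p ->] := env_surj u; have [q ->] := env_surj v.
by have [r ->] := env_surj w; rewrite -linearD !env_mulE mulrDr linearD.
Qed.

Lemma env_proj1_neq0 : env_proj 1 != 0.
Proof.
pose eps : {linear F -> k^o} := free_ext (fun s : seq X => (nilp s)%:R : k^o).
have epsW s : eps (free_word k s) = (nilp s)%:R by exact: free_extE.
have epsM p q : eps (p * q) = (eps p : k) * eps q.
  elim/free_ind: p => [|a s p IHp]; first by rewrite mul0r linear0 mul0r.
  rewrite mulrDl !linearD IHp [RHS]mulrDl; congr (_ + _).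
  rewrite -scalerAl !linearZ /= -[RHS]mulrA; congr (a * _) => {p IHp}.
  elim/free_ind: q => [|b t q IHq]; first by rewrite mulr0 linear0 mulr0.
  rewrite mulrDr !linearD IHq [RHS]mulrDr; congr (_ + _).
  rewrite -scalerAr !linearZ /= [RHS]mulrCA; congr (b * _).
  by rewrite free_wordM !epsW -natrM mulnb /nilp size_cat addn_eq0.
have epsG n (z : V n) : eps (gen z) = 0 by rewrite /gen -free_word1 epsW.
apply/eqP => /lproj_eq0; suff H p : in_span env_ideal p -> eps p = 0.
  by move/H; rewrite -(free_word0 k X) epsW => /eqP; rewrite oner_eq0.
elim=> [|a x y [b [s [c [Ss ->]]]] _ IH]; first exact: linear0.
rewrite linearP IH addr0 !epsM; suff -> : eps s = 0.
  by rewrite mulr0 mul0r scaler0.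
case: Ss => [n e z t | i j n e z t].
  by rewrite !linearB linearZ /= !epsG scaler0 !subr0.
by rewrite !linearB /= !epsM !epsG mulr0 !subr0.
Qed.

HB.instance Definition _ := GRing.Zmodule_isNzRing.Build env
  env_mulA env_mul1 env_mulr1 env_mulDl env_mulDr env_proj1_neq0.

Lemma env_projM p q : env_proj (p * q) = env_proj p * env_proj q.
Proof. by rewrite -env_mulE. Qed.
Lemma env_proj1 : env_proj 1 = 1. Proof. by []. Qed.

Lemma env_scalerAl (a : k) (u v : env) : a *: (u * v) = (a *: u) * v.
Proof.
have [p ->] := env_surj u; have [q ->] := env_surj v.
by rewrite -linearZ -!env_projM -linearZ -scalerAl.
Qed.
HB.instance Definition _ := GRing.Lmodule_isLalgebra.Build k env env_scalerAl.
Lemma env_scalerAr (a : k) (u v : env) : a *: (u * v) = u * (a *: v).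
Proof.
have [p ->] := env_surj u; have [q ->] := env_surj v.
by rewrite -linearZ -!env_projM -linearZ -scalerAr.
Qed.
HB.instance Definition _ := GRing.Lalgebra_isAlgebra.Build k env env_scalerAr.

Definition env_in n (x : V n) : env := env_proj (gen x).

Lemma env_in_linear n : linear (@env_in n).
Proof.
move=> a x y; apply/eqP; rewrite -subr_eq0 opprD addrA /env_in.
rewrite -linearZ -!linearB; apply/eqP/lproj_gen.
by exists 1, (gen (a *: x + y) - a *: gen x - gen y), 1; rewrite mul1r mulr1; split=> //; constructor.
Qed.
HB.instance Definition _ n :=
  GRing.isLinear.Build k (V n) env _ (@env_in n) (@env_in_linear n).

Lemma env_in_br i j n (e : (i + j)%N = n) x y :
  env_in (br g e x y) = env_in x * env_in y - env_in y * env_in x.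
Proof.
apply/eqP; rewrite eq_sym -subr_eq0 /env_in -!env_projM -!linearB.
apply/eqP/lproj_gen; exists 1, (gen x * gen y - gen y * gen x - gen (br g e x y)), 1.
by rewrite mul1r mulr1; split=> //; constructor.
Qed.

End Enveloping.

Section EnvelopingMaps.
Variables (k : fieldType) (V : nat -> lmodType k) (g : gradedLie V).

Local Notation X := {n : nat & V n}.
Local Notation U := (env g).
Local Notation UU := (tens_alg U U).

Definition env_gen (x : X) : U := env_in g (tagged x).
Definition env_word (s : seq X) : U := \prod_(x <- s) env_gen x.

Lemma env_proj_word s : env_proj g (free_word k s) = env_word s.
Proof.
elim: s => [|x s IH]; first by rewrite free_word0 env_proj1 /env_word big_nil.
rewrite -cat1s -free_wordM env_projM IH free_word1 /env_word big_cons.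
by case: x.
Qed.

(* The component of degree n of the enveloping algebra. *)
Definition env_comp (n : nat) : {pred U} :=
  lspan (fun u : U => exists2 s : seq X, \sum_(x <- s) tag x = n & u = env_word s).

Lemma env_lift (N : lmodType k) (G : {linear free_alg k X -> N}) :
  (forall s, env_ideal g s -> G s = 0) ->
  exists H : {linear U -> N}, forall p, H (env_proj g p) = G p.
Proof. by move=> GI; have [H HE] := lquot_lift GI; exists H. Qed.

Lemma tens_scalerAl (a : k) (s t : UU) : a *: (s * t) = (a *: s) * t.
Proof.
by rewrite -[LHS]/(a *: tmul s t) -[RHS]/(tmul (a *: s) t) /tmul linearZl_LR.
Qed.
Lemma tens_scalerAr (a : k) (s t : UU) : a *: (s * t) = s * (a *: t).
Proof.
by rewrite -[LHS]/(a *: tmul s t) -[RHS]/(tmul s (a *: t)) /tmul linearZr_LR.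
Qed.
Lemma tpureM (a b a' b' : U) :
  tpure a b * tpure a' b' = tpure (a * a') (b * b') :> UU.
Proof. exact: tmul_pure. Qed.

Let comm_aux (T : zmodType) (p q r s t u : T) :
  (p + q + (r + s)) - (t + r + (q + u)) = (p - t) + (s - u).
Proof.
apply/eqP; rewrite subr_eq (addrACA (p - t)) [q + u]addrC (addrA (p - t)) subrK.
by rewrite (addrA (s - u)) subrK [s + q]addrC (addrACA p).
Qed.

Lemma prim_mul (a b : U) :
  (tpure 1 a + tpure a 1) * (tpure 1 b + tpure b 1)
  = tpure 1 (a * b) + tpure b a + (tpure a b + tpure (a * b) 1) :> UU.
Proof. by rewrite mulrDl !mulrDr !tpureM !mul1r !mulr1. Qed.

Lemma prim_br (a b : U) :
  (tpure 1 a + tpure a 1) * (tpure 1 b + tpure b 1)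
  - (tpure 1 b + tpure b 1) * (tpure 1 a + tpure a 1)
  = tpure 1 (a * b - b * a) + tpure (a * b - b * a) 1 :> UU.
Proof.
rewrite !prim_mul /tpure linearBr linearBl.
exact: comm_aux.
Qed.

(* The coproduct is the algebra morphism making the elements of V n primitive. *)
Definition coproduct_exists :
  {D : {linear U -> UU} | [/\ D 1 = 1, {morph D : u v / u * v}
    & forall n (x : V n),
        D (env_in g x) = tpure 1 (env_in g x) + tpure (env_in g x) 1]}.
Proof.
apply: cid; pose del (x : X) : UU := tpure 1 (env_gen x) + tpure (env_gen x) 1.
pose G := free_ext (fun s : seq X => \prod_(x <- s) del x : UU).
have GW s : G (free_word k s) = \prod_(x <- s) del x by exact: free_extE.
have GM p q : G (p * q) = G p * G q.
  elim/free_ind: p => [|a s p IHp]; first by rewrite mul0r linear0 mul0r.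
  rewrite mulrDl !linearD IHp [RHS]mulrDl; congr (_ + _).
  rewrite -scalerAl !linearZ /= -tens_scalerAl; congr (a *: _) => {p IHp}.
  elim/free_ind: q => [|b t q IHq]; first by rewrite mulr0 linear0 mulr0.
  rewrite mulrDr !linearD IHq [RHS]mulrDr; congr (_ + _).
  rewrite -scalerAr !linearZ /= -tens_scalerAr; congr (b *: _).
  by rewrite free_wordM !GW big_cat.
have Gg n (x : V n) : G (gen x) = tpure 1 (env_in g x) + tpure (env_in g x) 1.
  by rewrite /gen -free_word1 GW big_seq1.
have [p|D DE] := env_lift (G := G).
  case=> [b [s [c [Ss ->]]]]; rewrite !GM; suff -> : G s = 0.
    by rewrite mulr0 mul0r.
  case: Ss => [n a x y | i j n e x y].
    rewrite !linearB linearZ /= !Gg linearP /tpure linearPr linearPl.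
    by rewrite addrACA -scalerDr addrAC addrK subrr.
  by rewrite !linearB /= !GM !Gg env_in_br prim_br subrr.
exists D; split.
- by rewrite -env_proj1 DE -free_word0 GW big_nil.
- move=> u v; have [p ->] := env_surj u; have [q ->] := env_surj v.
  by rewrite -env_projM !DE GM.
by move=> n x; rewrite DE Gg.
Qed.
Definition coproduct : {linear U -> UU} := sval coproduct_exists.
Lemma coproduct1 : coproduct 1 = 1.
Proof. by case: (svalP coproduct_exists). Qed.
Lemma coproductM : {morph coproduct : u v / u * v}.
Proof. by case: (svalP coproduct_exists). Qed.
Lemma coproduct_in n (x : V n) :
  coproduct (env_in g x) = tpure 1 (env_in g x) + tpure (env_in g x) 1.
Proof. by case: (svalP coproduct_exists). Qed.

(* The extension of d to a derivation of the enveloping algebra. *)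
Definition env_der_exists (d : derivation g) :
  {D : {linear U -> U} | (forall u v, D (u * v) = D u * v + u * D v)
    /\ forall n (x : V n), D (env_in g x) = env_in g (d n x)}.
Proof.
apply: cid; pose dgen (x : X) : U := env_in g (d (tag x) (tagged x)).
pose h : seq X -> U :=
  fix h s := if s is x :: s' then dgen x * env_word s' + env_gen x * h s' else 0.
have hM s t : h (s ++ t) = h s * env_word t + env_word s * h t.
  elim: s => [|x s IH] /=; first by rewrite mul0r add0r /env_word big_nil mul1r.
  rewrite IH mulrDr addrA mulrA mulrDl -!mulrA /env_word big_cat big_cons /=.
  by rewrite -!mulrA.
pose G := free_ext h.
have GW s : G (free_word k s) = h s by exact: free_extE.
have GM p q : G (p * q) = G p * env_proj g q + env_proj g p * G q.
  elim/free_ind: p => [|a s p IHp]; first by rewrite !mul0r !linear0 !mul0r addr0.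
  rewrite mulrDl !linearD IHp !mulrDl addrACA; congr (_ + _).
  rewrite -scalerAl !linearZ /= -!scalerAl -scalerDr; congr (a *: _) => {p IHp}.
  elim/free_ind: q => [|b t q IHq].
    by rewrite !mulr0 !linear0 !mulr0 addr0.
  rewrite mulrDr !linearD IHq !mulrDr addrACA; congr (_ + _).
  rewrite -scalerAr !linearZ /= -!scalerAr -scalerDr; congr (b *: _).
  by rewrite free_wordM !GW !env_proj_word hM.
have Gg n (x : V n) : G (gen x) = env_in g (d n x).
  by rewrite /gen -free_word1 GW /= /env_word big_nil mulr1 mulr0 addr0.
have proj0 s : env_rel g s -> env_proj g s = 0.
  by move=> Ss; apply/lproj_gen; exists 1, s, 1; rewrite mul1r mulr1.
have [p|D DE] := env_lift (G := G).
  case=> [b [s [c [Ss ->]]]]; rewrite !GM env_projM (proj0 _ Ss).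
  suff -> : G s = 0 by rewrite !(mulr0, mul0r, addr0).
  case: Ss => [n a x y | i j n e x y].
    by rewrite !linearB linearZ /= !Gg !linearP addrAC addrK subrr.
  rewrite !linearB /= !GM !Gg -!/(env_in g _) derP.
  rewrite (linearD (@env_in _ _ g n)) /= !env_in_br.
  by rewrite [X in _ - X - _]addrC opprD addrACA subrr.
exists D; split.
- move=> u v; have [p ->] := env_surj u; have [q ->] := env_surj v.
  by rewrite -env_projM !DE GM.
by move=> n x; rewrite DE Gg.
Qed.
Definition env_der (d : derivation g) : {linear U -> U} := sval (env_der_exists d).
Lemma env_derM d u v : env_der d (u * v) = env_der d u * v + u * env_der d v.
Proof. by case: (svalP (env_der_exists d)). Qed.
Lemma env_der_in d n (x : V n) : env_der d (env_in g x) = env_in g (d n x).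
Proof. by case: (svalP (env_der_exists d)). Qed.

End EnvelopingMaps.
Arguments env_comp {k V} g n.
Arguments coproduct {k V} g.
Arguments env_der {k V g} d.

Section Completion.
Variables (k : fieldType) (V : nat -> lmodType k) (g : gradedLie V).
Local Notation U := (env g).
Implicit Types (f h : nat -> U).

(* An element of the completion prod_n U_n is the sequence of its components; its
   product is the Cauchy product. *)
Definition in_cenv f := forall n, f n \in env_comp g n.

Definition cmul f h : nat -> U := fun n => \sum_(i < n.+1) f i * h (n - i)%N.

(* [cinv f] is the inverse of f in 1 + prod_(n >= 1) U_n, solved for degree by
   degree; it is meaningful only when f 0 = 1 (see [cmulVf]). *)
Fixpoint cinv_seq f n : seq U :=
  if n is m.+1 then
    rcons (cinv_seq f m)
      ((m == 0%N)%:R - \sum_(i < m) (cinv_seq f m)`_i * f (m - i)%N)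
  else [::].
Definition cinv f : nat -> U := fun n => (cinv_seq f n.+1)`_n.

Lemma size_cinv_seq f n : size (cinv_seq f n) = n.
Proof. by elim: n => //= n IH; rewrite size_rcons IH. Qed.
Lemma nth_cinv_seq f n i : (i < n)%N -> (cinv_seq f n)`_i = cinv f i.
Proof.
elim: n => // n IH; rewrite ltnS leq_eqVlt => /predU1P[-> // | lt_in].
by rewrite /= nth_rcons size_cinv_seq lt_in IH.
Qed.
Lemma cinvE f n :
  cinv f n = (n == 0%N)%:R - \sum_(i < n) cinv f i * f (n - i)%N.
Proof.
rewrite /cinv /= nth_rcons size_cinv_seq ltnn eqxx; congr (_ - _).
by apply: eq_bigr => i _; rewrite nth_cinv_seq.
Qed.
Lemma cmulVf f : f 0%N = 1 -> forall n, cmul (cinv f) f n = (n == 0%N)%:R.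
Proof.
by move=> f0 n; rewrite /cmul big_ord_recr /= subnn f0 mulr1 cinvE addrC subrK.
Qed.

Definition cder (d : derivation g) f : nat -> U := fun n => env_der d (f n).
Definition logd (d : derivation g) f : nat -> U := cmul (cinv f) (cder d f).

Definition cenv_in (u : forall n, V n) : nat -> U := fun n => env_in g (u n).

(* The completion of U (x) U is taken degreewise, the degree n part being
   (+)_(i + j = n) U_i (x) U_j; so Delta f = f (x) f is read in each degree. *)
Definition grouplike f :=
  [/\ in_cenv f, f 0%N = 1
    & forall n, coproduct g (f n)
        = \sum_(i < n.+1) tpure (f i) (f (n - i)%N) :> tens_alg U U].

End Completion.

(* Main.v *)
Require Import Defs.
From HB Require Import structures.
From mathcomp Require Import all_boot all_order all_algebra.
From mathcomp Require Import boolp.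
Import GRing.Theory.
Local Open Scope ring_scope.

Set Implicit Arguments.
Unset Strict Implicit.
Unset Printing Implicit Defensive.

(** Let E be the derivation acting on degree n as multiplication by n, and look
    for phi through its Euler logarithm w = phi^-1 E(phi) instead of its
    ordinary logarithm.

    In characteristic 0, any w in L is the Euler logarithm of exactly one phi
    with constant term 1, because E(phi) = phi w determines phi degree by degree
    ([euler_equation_solution], [euler_eq_unique]).  This phi is group-like: the
    series Delta(phi) and (phi (x) 1)(1 (x) phi) both solve
    E(X) = X (1 (x) w + w (x) 1) and both start with 1
    ([grouplike_of_euler]).

    As d is graded, it commutes with E, and the pair of equations E(phi) = phi w
    and d(phi) = phi u is compatible only when the connection is flat, that is when
    d(w) = E(u) + [w, u].  Conversely flatness suffices: the defect
    psi = d(phi) - phi u then satisfies E(psi) = psi w and has no constant term,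
    hence vanishes ([cder_of_flat]).

    Flatness is where the right inverse I enters.  Since L has no component of
    degree 0, the degree n part of [w, u] only involves components of w of degree
    less than n, so that w_n = I(n u_n + [w, u]_n) is a legitimate recursion
    ([flat_solution]). *)

(** * Recursion on the degree *)

(** Strong recursion for dependent families.  Picard iteration avoids carrying the
    dependent values through a recursor: the N-th iterate of F is already correct
    in degrees below N. *)
Lemma causal_fixpoint (T : nat -> Type) (x0 : forall n, T n)
    (F : (forall n, T n) -> forall n, T n) :
    (forall f h n, (forall i, (i < n)%N -> f i = h i) -> F f n = F h n) ->
  exists f, forall n, f n = F f n.
Proof.
move=> FC; pose X N := iter N F x0.
have X_stable n N : (n < N)%N -> X N n = X n.+1 n.
  elim/ltn_ind: n N => n IHn [//|N]; rewrite ltnS => le_nN.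
  apply: FC => i lt_in.
  exact: etrans (IHn i lt_in N (leq_trans lt_in le_nN)) (esym (IHn i lt_in n lt_in)).
exists (fun n => X n.+1 n) => n; apply: FC => i lt_in.
exact: X_stable.
Qed.

(** * Sequences under the Cauchy product *)

Section Series.
Variable R : pzRingType.

(** The alias keeps the Cauchy product from being attached to every function
    on nat; applied to the enveloping algebra, the product is convertible to
    [cmul]. *)
Definition series := nat -> R.
HB.instance Definition _ := gen_eqMixin series.
HB.instance Definition _ := gen_choiceMixin series.

Implicit Types f g h : series.

Definition series_zero : series := fun=> 0.
Definition series_add f g : series := fun n => f n + g n.
Definition series_opp f : series := fun n => - f n.

Fact series_addA : associative series_add.
Proof. by move=> f g h; apply: funext => n; apply: addrA. Qed.
Fact series_addC : commutative series_add.
Proof. by move=> f g; apply: funext => n; apply: addrC. Qed.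
Fact series_add0 : left_id series_zero series_add.
Proof. by move=> f; apply: funext => n; apply: add0r. Qed.
Fact series_addN : left_inverse series_zero series_opp series_add.
Proof. by move=> f; apply: funext => n; apply: addNr. Qed.
HB.instance Definition _ := GRing.isZmodule.Build series
  series_addA series_addC series_add0 series_addN.

Lemma seriesD f g n : (f + g) n = f n + g n. Proof. by []. Qed.
Lemma seriesB f g n : (f - g) n = f n - g n. Proof. by []. Qed.

Definition series_one : series := fun n => (n == 0%N)%:R.
Definition series_mul f g : series := fun n => \sum_(i < n.+1) f i * g (n - i)%N.

Lemma series_mul_rev f g n :
  series_mul f g n = \sum_(i < n.+1) f (n - i)%N * g i.
Proof.
rewrite /series_mul (reindex_inj rev_ord_inj) /=.
by apply: eq_bigr => i _; rewrite subSS subKn ?leq_ord.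
Qed.

Fact series_mulA : associative series_mul.
Proof.
move=> f g h; apply: funext => n; rewrite [RHS]series_mul_rev /series_mul.
pose c i j := f i * (g (n - i - j)%N * h j).
transitivity (\sum_(i < n.+1) \sum_(j < n.+1 | (j <= n - i)%N) c i j).
  apply: eq_bigr => i _; rewrite -/(series_mul g h _) series_mul_rev big_distrr /=.
  by rewrite (big_ord_narrow_leq (leq_subr _ _)).
rewrite (exchange_big_dep predT) //=; apply: eq_bigr => j _.
transitivity (\sum_(i < n.+1 | (i <= n - j)%N) c i j).
  by apply: eq_bigl => i; rewrite !leq_subRL ?leq_ord // addnC.
rewrite (big_ord_narrow_leq (leq_subr _ _)) big_distrl /=.
by apply: eq_bigr => i _; rewrite /c subnAC mulrA.
Qed.
Fact series_mul1 : left_id series_one series_mul.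
Proof.
move=> f; apply: funext => n; rewrite /series_mul big_ord_recl /= subn0 mul1r.
by rewrite big1 ?addr0 // => i _; rewrite mul0r.
Qed.
Fact series_mulr1 : right_id series_one series_mul.
Proof.
move=> f; apply: funext => n; rewrite series_mul_rev big_ord_recl /= subn0 mulr1.
by rewrite big1 ?addr0 // => i _; rewrite mulr0.
Qed.
Fact series_mulDl : left_distributive series_mul +%R.
Proof.
move=> f g h; apply: funext => n; rewrite seriesD -big_split.
by apply: eq_bigr => i _; apply: mulrDl.
Qed.
Fact series_mulDr : right_distributive series_mul +%R.
Proof.
move=> f g h; apply: funext => n; rewrite seriesD -big_split.
by apply: eq_bigr => i _; apply: mulrDr.
Qed.
HB.instance Definition _ := GRing.Zmodule_isPzRing.Build series
  series_mulA series_mul1 series_mulr1 series_mulDl series_mulDr.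

Lemma seriesM f g n : (f * g) n = \sum_(i < n.+1) f i * g (n - i)%N.
Proof. by []. Qed.

Lemma series_comm f g :
  (forall i j, f i * g j = g j * f i) -> f * g = g * f.
Proof.
move=> fgC; apply: funext => n; rewrite [LHS]series_mul_rev.
by apply: eq_bigr => i _; apply: fgC.
Qed.

Definition euler f : series := fun n => f n *+ n.

Lemma eulerB f g : euler (f - g) = euler f - euler g.
Proof. by apply: funext => n; rewrite /euler seriesB mulrnBl. Qed.

Lemma eulerM f g : euler (f * g) = euler f * g + f * euler g.
Proof.
apply: funext => n; rewrite /euler seriesD !seriesM -big_split -sumrMnl /=.
by apply: eq_bigr => i _; rewrite mulrnAl mulrnAr -mulrnDr subnKC ?leq_ord.
Qed.

(** In degree n the difference of two solutions, multiplied by n, only involves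
    the lower degrees because w 0 = 0; absence of torsion then gives a strong
    induction. *)
Lemma euler_eq_unique (f g w : series) :
    (forall n (x : R), x *+ n.+1 = 0 -> x = 0) ->
    w 0%N = 0 -> f 0%N = g 0%N -> euler f = f * w -> euler g = g * w ->
  f = g.
Proof.
move=> tf w0 fg0 Ef Eg.
have mulw h n : (h * w) n = \sum_(i < n) h i * w (n - i)%N.
  by rewrite seriesM big_ord_recr /= subnn w0 mulr0 addr0.
apply: funext; elim/ltn_ind=> -[//|n] IHn.
apply/eqP; rewrite -subr_eq0; apply/eqP/(tf n); rewrite mulrnBl.
rewrite -[f _ *+ _]/(euler f _) -[g _ *+ _]/(euler g _) Ef Eg !mulw.
rewrite -sumrB big1 // => i _.
by rewrite IHn // subrr.
Qed.

End Series.

Section SeriesMap.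
Variables (R S : pzRingType) (h : {additive R -> S}).

Definition map_series (f : series R) : series S := fun n => h (f n).

Lemma map_seriesM (f g : series R) :
  {morph h : x y / x * y} -> map_series (f * g) = map_series f * map_series g.
Proof.
move=> hM; apply: funext => n; rewrite /map_series !seriesM raddf_sum.
by apply: eq_bigr => i _; apply: hM.
Qed.

Lemma map_euler f : map_series (euler f) = euler (map_series f).
Proof. by apply: funext => n; apply: raddfMn. Qed.

End SeriesMap.

Lemma mulrn_eq0_char0 (k : fieldType) (M : lmodType k) :
  [pchar k] =i pred0 -> forall n (x : M), x *+ n.+1 = 0 -> x = 0.
Proof.
move=> /pcharf0P char0 n x /eqP.
by rewrite -scaler_nat scaler_eq0 char0 => /eqP.
Qed.

(** * Euler equations over the enveloping algebra *)

Section Enveloping.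
Variables (k : fieldType) (V : nat -> lmodType k) (g : gradedLie V).
Hypothesis char0 : [pchar k] =i pred0.
Local Notation U := (env g).
Local Notation UU := (tens_alg U U).

Local Notation lie_series w := (cenv_in g w : series U).

Lemma lie_deg0 n (x : V n) : n = 0%N -> x = 0.
Proof. by move=> n0; subst n; apply: (gradedLie0 g x). Qed.

Lemma cenv_in0 (w : forall n, V n) : cenv_in g w 0%N = 0.
Proof. by rewrite /cenv_in (lie_deg0 (w 0%N)) // linear0. Qed.

Lemma env_comp1 : 1 \in env_comp g 0.
Proof.
apply/lspanP/in_span_gen; exists [::]; first by rewrite big_nil.
by rewrite /env_word big_nil.
Qed.

Lemma env_comp_mul_in i j (a : U) (x : V j) :
  a \in env_comp g i -> a * env_in g x \in env_comp g (i + j).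
Proof.
move=> /lspanP; elim=> [|c b y [s <- ->] _ IH]; first by rewrite mul0r rpred0.
rewrite mulrDl -scalerAl rpredD ?rpredZ //.
pose X : {n : nat & V n} := existT _ j x.
apply/lspanP/in_span_gen; exists (rcons s X); first by rewrite big_rcons.
by rewrite /env_word big_rcons.
Qed.

(** The embeddings a |-> a (x) 1 and a |-> 1 (x) a, with commuting images, which
    factor the right-hand side of the group-like condition as a product. *)
Definition tens_inl (a : U) : UU := tpure a 1.
Definition tens_inr (a : U) : UU := tpure 1 a.

Fact tens_inl_zmod_morphism : zmod_morphism tens_inl.
Proof. by move=> a b; apply: linearBl. Qed.
Fact tens_inr_zmod_morphism : zmod_morphism tens_inr.
Proof. by move=> a b; apply: linearBr. Qed.
HB.instance Definition _ :=
  GRing.isZmodMorphism.Build U UU tens_inl tens_inl_zmod_morphism.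
HB.instance Definition _ :=
  GRing.isZmodMorphism.Build U UU tens_inr tens_inr_zmod_morphism.

Lemma tens_inlM : {morph tens_inl : a b / a * b}.
Proof. by move=> a b; rewrite /tens_inl tpureM mulr1. Qed.
Lemma tens_inrM : {morph tens_inr : a b / a * b}.
Proof. by move=> a b; rewrite /tens_inr tpureM mulr1. Qed.
Lemma tens_inl_inr a b : tens_inl a * tens_inr b = tpure a b.
Proof. by rewrite tpureM mulr1 mul1r. Qed.
Lemma tens_inr_inl a b : tens_inr b * tens_inl a = tpure a b.
Proof. by rewrite tpureM mulr1 mul1r. Qed.

Lemma env_der1 (d : derivation g) : env_der d 1 = 0.
Proof.
have := env_derM d 1 1; rewrite !mulr1 mul1r => /eqP.
by rewrite -subr_eq0 opprD addNKr oppr_eq0 => /eqP.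
Qed.

Lemma cderM (d : derivation g) (f h : series U) :
  cder d (f * h) = (cder d f : series U) * h + f * (cder d h : series U).
Proof.
apply: funext => n; rewrite /cder seriesD !seriesM linear_sum -big_split.
by apply: eq_bigr => i _; apply: env_derM.
Qed.

(** Delta(phi) and (phi (x) 1)(1 (x) phi) solve the same Euler equation.  For the
    second this is Leibniz' rule, together with the fact that w (x) 1 commutes
    with 1 (x) phi. *)
Lemma grouplike_of_euler (phi : series U) (w : forall n, V n) :
    in_cenv phi -> phi 0%N = 1 ->
    euler phi = phi * lie_series w ->
  grouplike phi.
Proof.
move=> phiC phi0 Ephi; split=> //.
pose W : series U := cenv_in g w.
pose l := map_series tens_inl; pose r := map_series tens_inr.
suff E : map_series (coproduct g) phi = l phi * r phi.
  move=> n; rewrite -[LHS]/(map_series (coproduct g) phi n) E seriesM.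
  by apply: eq_bigr => i _; apply: tens_inl_inr.
apply: (euler_eq_unique (w := map_series (coproduct g) W)).
- exact: mulrn_eq0_char0 char0.
- by rewrite /map_series /W cenv_in0 raddf0.
- by rewrite seriesM big_ord1 /= /l /r /map_series phi0 coproduct1 tens_inl_inr.
- by rewrite -map_euler Ephi map_seriesM //; apply: coproductM.
have -> : map_series (coproduct g) W = r W + l W.
  by apply: funext => n; apply: coproduct_in.
have lrC : l W * r phi = r phi * l W.
  by apply: series_comm => i j; rewrite tens_inl_inr tens_inr_inl.
rewrite eulerM -!map_euler Ephi.
rewrite (map_seriesM _ _ tens_inlM) (map_seriesM _ _ tens_inrM) -/l -/r.
by rewrite -mulrA lrC mulrDr addrC -!mulrA.
Qed.

(** Degree n of E(phi) = phi w reads n phi_n = sum_(i < n) phi_i w_(n - i): the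
    recursion divides by n, and stays in the degree n part of U because phi_i w_j
    has degree i + j. *)
Lemma euler_equation_solution (w : forall n, V n) :
  exists phi : series U, [/\ in_cenv phi, phi 0%N = 1
    & euler phi = phi * lie_series w].
Proof.
pose S (f : series U) n : U := \sum_(i < n) f i * env_in g (w (n - i)%N).
have [|phi phiE] := causal_fixpoint (T := fun=> U) (fun=> 0)
  (F := fun f n => if n is 0 then 1 else n%:R^-1 *: S f n).
  move=> f h [//|n] fh; congr (_ *: _); apply: eq_bigr => i _.
  by rewrite fh.
exists phi; split; last 1 first.
- apply: funext => n; rewrite seriesM big_ord_recr /= subnn.
  rewrite cenv_in0 mulr0 addr0 /euler phiE.
  case: n => [|n]; first by rewrite big_ord0.
  have /pcharf0P n0 := char0.
  by rewrite -scaler_nat scalerA divff ?scale1r // n0.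
- elim/ltn_ind=> n IHn; rewrite phiE; case: n IHn => [_|n IHn].
    exact: env_comp1.
  apply/rpredZ/rpred_sum => i _.
  by have := env_comp_mul_in (w (n.+1 - i)%N) (IHn i (ltn_ord i));
    rewrite subnKC // ltnW.
exact: phiE.
Qed.

(** This is the zero-curvature equation d(w) = E(u) + [w, u].  As u 0 = 0, the
    degree n part of [w, u] is known from the components of w below n, and I
    inverts d on it. *)
Lemma flat_solution (d : derivation g) (I : forall n, V n -> V n)
    (dI : forall n x, d n (I n x) = x) (u : forall n, V n) :
  exists w : forall n, V n,
    cder d (lie_series w) = euler (lie_series u)
      + (lie_series w * lie_series u - lie_series u * lie_series w).
Proof.
pose B n (w : forall n, V n) (i : 'I_n.+1) : V n :=
  br g (subnKC (leq_ord i)) (w i) (u (n - i)%N).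
have [|w wE] := causal_fixpoint (T := V) (fun=> 0)
  (F := fun w n => I n (u n *+ n + \sum_(i < n.+1) B n w i)).
  move=> f h n fh; congr (I n (_ + _)); apply: eq_bigr => i _; rewrite /B.
  (* The summand i = n involves f n itself, but only bracketed with u 0 = 0. *)
  have [/fh -> //|] := ltnP i n; rewrite -subn_eq0 => /eqP ni0.
  by rewrite (lie_deg0 (u _) ni0) !linear0r.
exists w; apply: funext => n.
rewrite /cder env_der_in wE dI linearD linearMn linear_sum /=.
rewrite seriesD seriesB [(lie_series u * _) n]series_mul_rev seriesM -sumrB.
by congr (_ + _); apply: eq_bigr => i _; apply: env_in_br.
Qed.

(** With psi = d(phi) - phi u, commuting d and E gives
    E(psi) = d(phi) w + phi d(w) - phi w u - phi E(u), which flatness turns into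
    d(phi) w - phi u w = psi w. *)
Lemma cder_of_flat (d : derivation g) (u w : forall n, V n) (phi : series U) :
    phi 0%N = 1 -> euler phi = phi * lie_series w ->
    cder d (lie_series w) = euler (lie_series u)
      + (lie_series w * lie_series u - lie_series u * lie_series w) ->
  cder d phi = phi * lie_series u.
Proof.
set W := lie_series w; set u' := lie_series u => phi0 Ephi Wflat.
pose dphi : series U := cder d phi; pose dW : series U := cder d W.
have Edphi : euler dphi = dphi * W + phi * dW.
  by rewrite -cderM -Ephi; apply: funext => n; apply/esym/linearMn.
apply/(@subr0_eq (series U)); rewrite -/dphi.
apply: (euler_eq_unique (w := W)).
- exact: mulrn_eq0_char0 char0.
- exact: cenv_in0.
- by rewrite seriesB seriesM big_ord1 /u' cenv_in0 mulr0 /dphi /cder phi0 env_der1 subr0.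
- rewrite eulerB Edphi eulerM Ephi /dW Wflat.
  rewrite mulrDr mulrBr mulrBl !mulrA [_ + (_ - _)]addrA [phi * euler _ + _]addrC.
  by rewrite addrA addrAC addrK.
by rewrite mul0r; apply: funext => n; apply: mul0rn.
Qed.

Lemma logd_of_cder (d : derivation g) (phi U0 : series U) :
  phi 0%N = 1 -> cder d phi = phi * U0 -> logd d phi = U0.
Proof.
move=> phi0 dphi; pose iphi : series U := cinv phi.
have iphiM : iphi * phi = 1 by apply: funext => n; apply: cmulVf.
rewrite -[logd d phi]/(iphi * (cder d phi : series U)) dphi.
by rewrite mulrA iphiM mul1r.
Qed.

Lemma logd_right_inverse (d : derivation g) (I : forall n, V n -> V n)
    (dI : forall n x, d n (I n x) = x) (u : forall n, V n) :
  exists phi : series U, grouplike phi /\ logd d phi = lie_series u.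
Proof.
have [w w_flat] := flat_solution dI u.
have [phi [phiC phi0 Ephi]] := euler_equation_solution w.
exists phi; split; first exact: grouplike_of_euler phiC phi0 Ephi.
exact/(logd_of_cder phi0)/(cder_of_flat phi0 Ephi w_flat).
Qed.

End Enveloping.

Unset Implicit Arguments.

Theorem theorem1 (k : fieldType) (char0 : [pchar k] =i pred0)
    (V : nat -> vectType k) (Lk : gradedLie (fun n : nat => V n))
    (A : comAlgType k)
    (d : derivation (lie_ext Lk A))
    (I : forall n : nat, {linear tens A (V n) -> tens A (V n)})
    (dI : forall (n : nat) (x : tens A (V n)), d n (I n x) = x)
    (u : forall n : nat, tens A (V n)) :
  exists phi : nat -> env (lie_ext Lk A),
    grouplike phi /\ logd d phi = cenv_in (lie_ext Lk A) u.
Proof. exact: (logd_right_inverse char0 dI u). Qed.
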